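(* Let $G$ be a $\Delta$-regular graph with $0\le\Delta\le 3$ and let $G^*$ be another graph. If $A(G^*;x)=A(G;x)$, then $G^*$ is a $\Delta$-regular graph with the same order, size and number of connected components as $G$.
   Context: Graphs are finite, simple, nonempty, and not necessarily connected; the order is the number of vertices and the size is the number of edges. For a graph $G=(V,E)$ with order $n$ and maximum degree $\Delta$, and $X\subseteq V$, $\delta_X(v)$ is the number of neighbours of $v$ in $X$, $\overline{X}=V\setminus X$, and $\langle X\rangle$ is the induced subgraph. $G$ is $\Delta$-regular if all its vertices have degree $\Delta$. For a nonempty $S\subseteq V$ with $\langle S\rangle$ connected, and an integer $k\in[-\Delta,\Delta]$, $S$ is a defensive $k$-alliance if $\delta_S(v)\ge\delta_{\overline S}(v)+k$ for every $v\in S$; the exact index of alliance of $S$ is $k_S=\max\{k\in[-\Delta,\Delta]\cap\mathbb Z: S\text{ is a defensive }k\text{-alliance}\}=\min_{v\in S}\{\delta_S(v)-\delta_{\overline S}(v)\}$, and $S$ is called an exact defensive $k_S$-alliance. $A_k(G)$ denotes the number of exact defensive $k$-alliances in $G$ (subsets $S\subseteq V$), and the alliance polynomial of $G$ is $A(G;x)=\sum_{k=-\Delta}^{\Delta}A_k(G)\,x^{n+k}$ (where $n$ and $\Delta$ are the order and maximum degree of the graph in question). *)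

(* Defs.v *)
From mathcomp Require Import all_boot all_order all_algebra.

Set Implicit Arguments.
Unset Strict Implicit.
Unset Printing Implicit Defensive.

Import Order.TTheory GRing.Theory Num.Theory.
Local Open Scope ring_scope.

Record sgraph := SGraph {
  vertex :> finType;
  adj : rel vertex;
  adj_sym : symmetric adj;
  adj_irrefl : irreflexive adj;
  vertex_gt0 : (0 < #|vertex|)%N
}.

Definition gorder (G : sgraph) : nat := #|G|.

Definition edges (G : sgraph) : {set {set G}} :=
  [set A : {set G} | [exists u, exists v, adj u v && (A == [set u; v])]].

Definition gsize (G : sgraph) : nat := #|edges G|.

Definition num_components (G : sgraph) : nat := n_comp (@adj G) predT.

Definition degree_in (G : sgraph) (X : {set G}) (v : G) : nat :=
  #|[set u in X | adj v u]|.

Definition degree (G : sgraph) (v : G) : nat := degree_in [set: G] v.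

Definition max_degree (G : sgraph) : nat := (\max_(v : G) degree v)%N.

Definition regular (d : nat) (G : sgraph) : Prop :=
  forall v : G, degree v = d.

Definition induced_adj (G : sgraph) (S : {set G}) : rel G :=
  [rel u v | [&& u \in S, v \in S & adj u v]].

Definition induced_connected (G : sgraph) (S : {set G}) : bool :=
  [forall u in S, forall v in S, connect (induced_adj S) u v].

Definition alliance_range (G : sgraph) : seq int :=
  [seq i%:Z - (max_degree G)%:Z | i <- iota 0 (2 * max_degree G).+1%N].

Definition defensive_alliance (G : sgraph) (k : int) (S : {set G}) : bool :=
  [&& S != set0, induced_connected S, k \in alliance_range G &
      [forall v in S, (degree_in (~: S) v)%:Z + k <= (degree_in S v)%:Z]].

(* A nonempty S with connected induced subgraph is always a defensive
   (-Delta)-alliance, so the default value of the maximum is harmless there. *)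
Definition exact_index (G : sgraph) (S : {set G}) : int :=
  \big[Order.max/ - (max_degree G)%:Z]_(k <- alliance_range G
                                       | defensive_alliance k S) k.

Definition exact_alliance (G : sgraph) (k : int) (S : {set G}) : bool :=
  [&& S != set0, induced_connected S & exact_index S == k].

Definition num_exact_alliances (G : sgraph) (k : int) : nat :=
  #|[set S : {set G} | exact_alliance k S]|.

(* Since Delta < n, every exponent n + k is positive, so taking the absolute
   value only serves to read it as a natural number. *)
Definition alliance_poly (G : sgraph) : {poly int} :=
  \sum_(k <- alliance_range G)
     (num_exact_alliances G k)%:Z *: 'X^(absz ((gorder G)%:Z + k)).

(* Main.v *)
(** The coefficient of x^(n+k) counts the connected sets of exact index k.  The
lowest term has degree n - max degree and counts the vertices of maximum degree,
so for some t >= 0 the graph G* has n + t vertices and maximum degree Delta + t,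
attained by exactly n vertices.  The top term of A(G;x) counts the components
of G, of which there are at most n - Delta; hence in G* every exact index is at
most Delta - t, and at most n - Delta connected sets attain this value.

Suppose t >= 1.  For a vertex v of maximum degree, let C be a component of
G* - v containing a neighbour of v.  Each vertex of C has at most one neighbour
outside C, namely v.  All exact indices of G being congruent to Delta modulo 2,
the degrees in G* are congruent to Delta + t, and since Delta <= 3 it follows
that C has exact index Delta - t unless v is adjacent to a vertex of degree
Delta - t.  There are at most t (Delta - t) < Delta exceptional v, and C
determines v, so more than n - Delta sets have exact index Delta - t, a
contradiction. *)
Require Import Defs.
From mathcomp Require Import all_boot all_order all_algebra.
From mathcomp Require Import zify.

Set Implicit Arguments.
Unset Strict Implicit.
Unset Printing Implicit Defensive.

Import Order.TTheory GRing.Theory Num.Theory.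

(** * Degrees and the range of indices *)

Lemma degree_inC (G : sgraph) (X : {set G}) (v : G) :
  degree_in X v + degree_in (~: X) v = degree v.
Proof.
rewrite /degree /degree_in -(cardsID X [set u in [set: G] | adj v u]).
by congr (_ + _); apply: eq_card => u; rewrite !inE andbC.
Qed.

Lemma degree_in_self (G : sgraph) (v : G) : degree_in [set v] v = 0.
Proof.
apply/eqP; rewrite cards_eq0; apply/eqP/setP => u; rewrite !inE.
by case: eqP => // ->; rewrite adj_irrefl.
Qed.

Lemma degree_in0 (G : sgraph) (v : G) : degree_in set0 v = 0.
Proof. by apply/eqP; rewrite cards_eq0; apply/eqP/setP => u; rewrite !inE. Qed.

Lemma degree_le_max (G : sgraph) (v : G) : degree v <= max_degree G.
Proof. exact: leq_bigmax. Qed.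

Lemma max_degree_attained (G : sgraph) : exists v : G, degree v = max_degree G.
Proof.
rewrite /max_degree; have [v ->] := bigop.eq_bigmax (@degree G) (vertex_gt0 G).
by exists v.
Qed.

Lemma max_degree_lt_order (G : sgraph) : max_degree G < gorder G.
Proof.
have [v <-] := max_degree_attained G; rewrite /gorder -cardsT.
apply: proper_card; apply/properP; split; first exact: subsetT.
by exists v; rewrite ?inE // adj_irrefl.
Qed.

Lemma mem_alliance_range (G : sgraph) (k : int) :
  (k \in alliance_range G) = (`|k| <= max_degree G)%N.
Proof.
apply/mapP/idP => [[i] | hk].
  by rewrite mem_iota => hi ->; lia.
by exists (`|(k + (max_degree G)%:Z)%R|)%N; rewrite ?mem_iota; lia.
Qed.

Lemma alliance_range_uniq (G : sgraph) : uniq (alliance_range G).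
Proof. by rewrite map_inj_uniq ?iota_uniq // => i j; lia. Qed.

(** * The exact index as an attained minimum *)

Section ExactIndex.

Variables (G : sgraph) (S : {set G}).
Hypotheses (S0 : S != set0) (cS : induced_connected S).

Lemma exact_index_defensive : defensive_alliance (exact_index S) S.
Proof.
rewrite /exact_index; apply: (big_ind (fun k => defensive_alliance k S)) => [|x y hx hy|k //].
  (* The default value is admissible: no vertex has more than [max_degree G] neighbours outside
     [S]. *)
  apply/and4P; split; rewrite ?mem_alliance_range //; first lia.
  apply/forall_inP => v vS.
  by have := degree_inC S v; have := degree_le_max v; lia.
by rewrite /Order.max; case: ifP.
Qed.

Lemma exact_index_le (v : G) : v \in S ->
  ((degree_in (~: S) v)%:Z + exact_index S <= (degree_in S v)%:Z)%R.
Proof.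
by case/and4P: exact_index_defensive => _ _ _ /forall_inP hS; apply: hS.
Qed.

Lemma exact_index_range : (`|exact_index S| <= max_degree G)%N.
Proof. by case/and4P: exact_index_defensive; rewrite mem_alliance_range. Qed.

(* If every inequality were strict, the index could be increased by one. *)
Lemma exact_index_attained :
  exists2 v : G, v \in S &
    ((degree_in S v)%:Z = (degree_in (~: S) v)%:Z + exact_index S)%R.
Proof.
case: (boolP [exists v in S, ((degree_in S v)%:Z ==
    (degree_in (~: S) v)%:Z + exact_index S)%R]) => [/exists_inP[v vS /eqP] | hno].
  by exists v.
suff: (exact_index S + 1 <= exact_index S)%R by lia.
have hlt v : v \in S ->
    ((degree_in (~: S) v)%:Z + (exact_index S + 1) <= (degree_in S v)%:Z)%R.
  move=> vS; have := exact_index_le vS.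
  by have /eqP := exists_inPn hno v vS; lia.
have hd : defensive_alliance (exact_index S + 1)%R S.
  have [v vS] := set0Pn _ S0.
  apply/and4P; split => //; last exact/forall_inP.
  rewrite mem_alliance_range; have := hlt v vS; have := exact_index_range.
  by have := degree_inC S v; have := degree_le_max v; lia.
have hr : (exact_index S + 1)%R \in alliance_range G by case/and4P: hd.
exact: (le_bigmax_seq _ _ (fun k => defensive_alliance k S) id hr hd).
Qed.

(** [k] need not lie in [alliance_range G]: the bound is read off at a vertex where the index is
    attained. *)
Lemma exact_index_ge (k : int) :
  (forall v, v \in S -> (degree_in (~: S) v)%:Z + k <= (degree_in S v)%:Z)%R ->
  (k <= exact_index S)%R.
Proof. by move=> hk; have [v /hk] := exact_index_attained; lia. Qed.

End ExactIndex.

(** * Coefficients of the alliance polynomial *)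

Definition index_sets (G : sgraph) (k : int) : {set {set G}} :=
  [set S : {set G} | exact_alliance k S].

Lemma index_setsP (G : sgraph) (k : int) (S : {set G}) :
  reflect [/\ S != set0, induced_connected S & exact_index S = k]
          (S \in index_sets G k).
Proof.
rewrite inE; apply: (iffP and3P) => -[? ? h]; split=> //; exact/eqP.
Qed.

Lemma coef_alliance_poly (G : sgraph) (m : nat) :
  ((alliance_poly G)`_m)%R = Posz #|index_sets G (m%:Z - (gorder G)%:Z)%R|.
Proof.
have hG := max_degree_lt_order G.
rewrite /alliance_poly coef_sum; set k : int := (m%:Z - _)%R.
(* The maximum degree is below the order, so the exponents n + j are positive and [absz] merges no
   two of them. *)
have hcoef (j : int) : j \in alliance_range G -> j != k ->
    (((num_exact_alliances G j)%:Z *: 'X^(absz ((gorder G)%:Z + j)))`_m = 0)%R.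
  rewrite mem_alliance_range coefZ coefXn => hj hjk.
  by case: (m =P _) => [|_]; [lia | rewrite mulr0].
case: (boolP (k \in alliance_range G)) => hk.
  rewrite (bigD1_seq k) ?alliance_range_uniq //= big_seq_cond big1 => [|j /andP[]].
    have -> : ((gorder G)%:Z + k = m%:Z)%R by rewrite /k; lia.
    by rewrite addr0 coefZ coefXn absz_nat eqxx mulr1 /num_exact_alliances ?natz.
  exact: hcoef.
rewrite big_seq big1 => [|j hj]; last by apply: hcoef => //; apply: contraNneq hk => <-.
apply/eqP; rewrite eq_sym; apply/eqP; congr Posz; apply/eqP; rewrite cards_eq0.
apply: contraR hk => /set0Pn[S /index_setsP[S0 cS <-]].
by rewrite mem_alliance_range exact_index_range.
Qed.

Lemma index_sets_eq0 (G : sgraph) (k : int) :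
  (max_degree G < `|k|)%N -> index_sets G k = set0.
Proof.
move=> hk; apply/setP => S; rewrite [RHS]inE; apply/negP.
move=> /index_setsP[S0 cS hS]; have := exact_index_range S0 cS; lia.
Qed.

Lemma card_index_sets_shift (G H : sgraph) (k : int) :
  alliance_poly H = alliance_poly G ->
  #|index_sets H k| = #|index_sets G (k + (gorder H)%:Z - (gorder G)%:Z)%R|.
Proof.
move=> hpoly; have hH := max_degree_lt_order H; have hG := max_degree_lt_order G.
(* For a negative exponent there is no coefficient to compare, but then [k] and its shift both lie
   outside the ranges and both counts are 0. *)
case: (leP 0%R (k + (gorder H)%:Z)%R) => hk; last first.
  by rewrite !index_sets_eq0 ?cards0 //; lia.
have := congr1 (fun p : {poly int} => p`_(`|(k + (gorder H)%:Z)%R|)%N)%R hpoly.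
rewrite !coef_alliance_poly => -[].
by rewrite (_ : Posz `|_|%N = k + (gorder H)%:Z)%R ?addrK //; lia.
Qed.

(** * Components of induced subgraphs *)

Lemma induced_adjE (G : sgraph) (S : {set G}) (u v : G) :
  induced_adj S u v = [&& u \in S, v \in S & adj u v].
Proof. by []. Qed.

Lemma induced_adjT (G : sgraph) : induced_adj [set: G] =2 @adj G.
Proof. by move=> u v; rewrite induced_adjE !inE. Qed.

Lemma adj_connect_sym (G : sgraph) : connect_sym (@adj G).
Proof. exact/sym_connect_sym/adj_sym. Qed.

Section Closure.

Variables (G : sgraph) (A : {set G}).

(** For [y] outside [A] this is the singleton of [y], so nonemptiness and connectedness hold without
    assuming [y \in A]. *)
Definition component_in (y : G) : {set G} :=
  [set z | connect (induced_adj A) y z].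

Lemma induced_adj_sym (S : {set G}) : connect_sym (induced_adj S).
Proof.
by apply: sym_connect_sym => u v; rewrite !induced_adjE adj_sym !andbA (andbC (u \in S)).
Qed.

Lemma component_in_refl (y : G) : y \in component_in y.
Proof. by rewrite inE connect0. Qed.

Lemma component_in_neq0 (y : G) : component_in y != set0.
Proof. by apply/set0Pn; exists y; apply: component_in_refl. Qed.

Lemma component_in_connected (y : G) : induced_connected (component_in y).
Proof.
have hy z : z \in component_in y -> connect (induced_adj (component_in y)) y z.
  have step p x : x \in component_in y ->
      connect (induced_adj (component_in y)) y x -> path (induced_adj A) x p ->
      connect (induced_adj (component_in y)) y (last x p).
    elim: p x => [|w p IHp] x //= xC yx /andP[xw hp].
    have wC : w \in component_in y.
      rewrite inE; apply: connect_trans (connect1 xw).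
      by rewrite inE in xC.
    apply: IHp => //; apply: connect_trans yx (connect1 _).
    by rewrite induced_adjE xC wC; case/and3P: xw.
  rewrite inE => /connectP[p hp ->].
  exact: step (component_in_refl y) (connect0 _ y) hp.
apply/forall_inP => u uC; apply/forall_inP => v vC.
by apply: connect_trans (hy v vC); rewrite induced_adj_sym hy.
Qed.

Lemma component_in_sub (y : G) : y \in A -> component_in y \subset A.
Proof.
move=> yA; apply/subsetP => z; rewrite inE => /connectP[p].
elim: p y yA => [|w p IHp] y yA /= => [_ -> //|/andP[/and3P[_ wA _] hp]].
exact: IHp.
Qed.

Lemma component_in_step (y u v : G) : y \in A ->
  u \in component_in y -> v \in A -> adj u v -> v \in component_in y.
Proof.
move=> yA uC vA uv; have uA := subsetP (component_in_sub yA) u uC.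
move: uC; rewrite !inE => uC; apply: connect_trans uC (connect1 _).
by rewrite induced_adjE uA vA.
Qed.

(** A neighbour of the component that lies in [A] belongs to the component, so edges leaving the
    component also leave [A]. *)
Lemma degree_in_component_in (y u : G) : y \in A -> u \in component_in y ->
  degree_in (~: component_in y) u <= degree_in (~: A) u.
Proof.
move=> yA uC; apply/subset_leq_card/subsetP => v; rewrite !inE => /andP[vC uv].
rewrite uv andbT; apply: contra vC => vA.
by have := component_in_step yA uC vA uv; rewrite inE.
Qed.

End Closure.

(** * Singletons and the lowest term *)

Lemma connected_isolated (G : sgraph) (S : {set G}) (v : G) :
  induced_connected S -> v \in S -> degree_in S v = 0 -> S = [set v].
Proof.
move=> cS vS /eqP; rewrite cards_eq0 => /eqP dv.
apply/eqP; rewrite eqEsubset sub1set vS andbT; apply/subsetP => u uS.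
have /connectP[[_ ->|w p /= /andP[/and3P[_ wS vw] _] _]] :=
  forall_inP (forall_inP cS v vS) u uS; first by rewrite inE.
by have := in_set0 w; rewrite -dv inE wS vw.
Qed.

(** Through singletons, every constraint on exact indices becomes a constraint on degrees. *)
Lemma set1_index_sets (G : sgraph) (v : G) :
  [set v] \in index_sets G (- (degree v)%:Z)%R.
Proof.
have S0 : [set v] != set0 by apply/set0Pn; exists v; rewrite inE.
have cS : induced_connected [set v].
  apply/forall_inP => u /set1P->; apply/forall_inP => w /set1P->.
  exact: connect0.
apply/index_setsP; split=> //.
have [w /set1P->] := exact_index_attained S0 cS.
by have := degree_inC [set v] v; rewrite degree_in_self; lia.
Qed.

(** A vertex attaining the index has all its neighbours outside [S], so connectedness leaves nothing
    else in [S]. *)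
Lemma index_sets_min (G : sgraph) :
  index_sets G (- (max_degree G)%:Z)%R =
  [set [set v] | v in [set v : G | degree v == max_degree G]].
Proof.
apply/setP => S; apply/idP/imsetP => [/index_setsP[S0 cS hS]|[v]].
  have [v vS] := exact_index_attained S0 cS.
  have := degree_inC S v; have := degree_le_max v; rewrite hS => h1 h2 h3.
  exists v; first by rewrite inE; apply/eqP; lia.
  by apply: connected_isolated => //; lia.
by rewrite inE => /eqP <- ->; apply: set1_index_sets.
Qed.

Lemma card_index_sets_min (G : sgraph) :
  #|index_sets G (- (max_degree G)%:Z)%R| =
  #|[set v : G | degree v == max_degree G]|.
Proof. by rewrite index_sets_min card_imset //; apply: set1_inj. Qed.

Lemma card_index_sets_min_gt0 (G : sgraph) :
  0 < #|index_sets G (- (max_degree G)%:Z)%R|.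
Proof.
rewrite card_index_sets_min; have [v hv] := max_degree_attained G.
by apply/card_gt0P; exists v; rewrite inE hv.
Qed.

(** The lowest exponent of [H] also occurs for [G], where no exponent is below n minus the maximum
    degree. *)
Lemma order_sub_max_degree_le (G H : sgraph) :
  alliance_poly H = alliance_poly G ->
  gorder G - max_degree G <= gorder H - max_degree H.
Proof.
move=> hpoly; have := card_index_sets_min_gt0 H.
rewrite (card_index_sets_shift _ hpoly) => /card_gt0P[S].
move=> /index_setsP[S0 cS hS]; have := exact_index_range S0 cS.
have := max_degree_lt_order H; have := max_degree_lt_order G.
by rewrite hS; lia.
Qed.

(** * Regular graphs: top term, number of components, parity of indices *)

Lemma regular_max_degree (d : nat) (G : sgraph) : regular d G -> max_degree G = d.
Proof. by move=> hG; have [v <-] := max_degree_attained G. Qed.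

(** Index [d] leaves no room for an edge out of [S], so [S] is closed under adjacency. *)
Lemma index_sets_regular_max (d : nat) (G : sgraph) : regular d G ->
  index_sets G d = [set component_in setT x | x in roots (@adj G)].
Proof.
move=> hG.
have sym := @adj_connect_sym G.
have compE x y : (y \in component_in setT x) = connect (@adj G) x y.
  by rewrite inE (eq_connect (@induced_adjT G)).
apply/setP => S; apply/idP/imsetP => [/index_setsP[S0 cS hS]|[x _ ->]].
  have [x xS] := set0Pn _ S0; exists (fingraph.root (@adj G) x); first exact: roots_root.
  have closedS u v : u \in S -> adj u v -> v \in S.
    move=> uS uv; have := exact_index_le S0 cS uS.
    have := degree_inC S u; rewrite hS hG => h1 h2.
    have /eqP : degree_in (~: S) u = 0 by lia.
    rewrite cards_eq0 => /eqP/setP/(_ v); rewrite !inE uv andbT.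
    by move/negbFE.
  apply/setP => y; rewrite compE -(same_connect sym (connect_root _ x)).
  apply/idP/idP => [yS|].
    have := forall_inP (forall_inP cS x xS) y yS.
    by apply: connect_sub => u v /and3P[_ _ /connect1].
  case/connectP=> p; elim: p x xS {S0} => [|w p IHp] x xS /= => [_ -> //|/andP[xw]].
  exact/IHp/(closedS x).
have S0 := component_in_neq0 setT x; have cS := component_in_connected setT x.
apply/index_setsP; split=> //; apply/le_anti/andP; split.
  by have := exact_index_range S0 cS; rewrite (regular_max_degree hG); lia.
apply: exact_index_ge => // v vC.
have := degree_in_component_in (in_setT x) vC; rewrite setCT degree_in0.
by have := degree_inC (component_in setT x) v; rewrite hG; lia.
Qed.

Lemma card_index_sets_regular_max (d : nat) (G : sgraph) : regular d G ->
  #|index_sets G d| = num_components G.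
Proof.
move=> hG; rewrite (index_sets_regular_max hG) card_in_imset.
  by rewrite /num_components /n_comp_mem; apply: eq_card => x; rewrite !inE andbT.
have sym := @adj_connect_sym G.
move=> x y /eqP rx /eqP ry hxy; rewrite -rx -ry.
apply/fingraph.rootP => //; rewrite -(eq_connect (@induced_adjT G)).
by have := component_in_refl setT y; rewrite -hxy inE.
Qed.

(* The neighbours of a chosen component representative are not representatives. *)
Lemma num_components_regular_le (d : nat) (G : sgraph) : regular d G ->
  num_components G + d <= gorder G.
Proof.
move=> hG; have sym := @adj_connect_sym G.
have [v0 _] := max_degree_attained G; pose v := fingraph.root (@adj G) v0.
pose R := [set x | roots (@adj G) x]; pose N := [set u in [set: G] | adj v u].
have -> : num_components G = #|R|.
  by rewrite /num_components /n_comp_mem; apply: eq_card => x; rewrite !inE andbT.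
have <- : #|N| = d by apply: hG.
rewrite -cardsUI (_ : R :&: N = set0) ?cards0 ?addn0 ?max_card //.
apply/setP => u; rewrite !inE; apply/negP => /andP[/eqP ru vu].
have hr : fingraph.root (@adj G) v = fingraph.root (@adj G) u by apply/fingraph.rootP/connect1.
by have /eqP := roots_root sym v0; rewrite -/v hr ru => uv; rewrite uv adj_irrefl in vu.
Qed.

Lemma sum_degree (G : sgraph) : \sum_(v : G) degree v = 2 * gsize G.
Proof.
have -> : 2 * gsize G = \sum_(A in edges G) #|A|.
  rewrite mulnC /gsize -sum_nat_const; apply: eq_bigr => A.
  rewrite inE => /existsP[u /existsP[v /andP[uv /eqP->]]].
  by rewrite cards2; case: eqP uv => // ->; rewrite adj_irrefl.
transitivity (\sum_(v : G) \sum_(A in edges G | v \in A) 1).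
  (* Double counting of incidences: u |-> {v, u} matches the neighbours of [v] with the edges
     through [v]. *)
  apply: eq_bigr => v _; rewrite sum1_card /degree /degree_in -(@card_in_imset _ _ (fun u => [set v; u])).
    apply: eq_card => A; apply/imsetP/andP => [[u]|[]].
      rewrite !inE => /andP[_ vu] ->; rewrite !inE eqxx; split=> //.
      by apply/existsP; exists v; apply/existsP; exists u; rewrite vu eqxx.
    rewrite inE => /existsP[u /existsP[w /andP[uw /eqP->]]].
    rewrite !inE => /orP[]/eqP->; [exists w | exists u] => //; rewrite ?inE //.
      by rewrite adj_sym.
    by rewrite setUC.
  move=> u w; rewrite !inE => /= vu vw /setP/(_ u).
  rewrite !inE eqxx orbT => /esym/orP[]/eqP // uv.
  by rewrite uv adj_irrefl in vu.
rewrite (exchange_big_dep (mem (edges G))) //=; last by move=> ? ? _ /andP[].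
by apply: eq_bigr => A AE; rewrite -sum1_card; apply: eq_bigl => v; rewrite AE.
Qed.

Lemma index_sets_regular (d : nat) (G : sgraph) (k : int) (S : {set G}) :
  regular d G -> S \in index_sets G k ->
  exists2 a : nat, a <= d & (k = 2 * a%:Z - d%:Z)%R.
Proof.
move=> hG /index_setsP[S0 cS <-].
have [v _] := exact_index_attained S0 cS; have := degree_inC S v.
by rewrite hG => h1 h2; exists (degree_in S v); lia.
Qed.

(** * Components left after deleting a vertex *)

Section PuncturedComponent.

Variable G : sgraph.

Definition a_neighbour (v : G) : G := odflt v [pick u | adj v u].

Definition punctured_component (v : G) : {set G} :=
  component_in [set~ v] (a_neighbour v).

Lemma adj_degree_gt0 (u v : G) : adj u v -> 0 < degree u.
Proof. by move=> uv; apply/card_gt0P; exists v; rewrite !inE. Qed.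

Lemma adj_a_neighbour (v : G) : 0 < degree v -> adj v (a_neighbour v).
Proof.
case/card_gt0P => u; rewrite !inE /= /a_neighbour => vu.
by case: pickP => //= /(_ u); rewrite vu.
Qed.

Lemma a_neighbour_in (v : G) : 0 < degree v -> a_neighbour v \in [set~ v].
Proof.
move=> /adj_a_neighbour hv; rewrite !inE.
by apply: contraTneq hv => ->; rewrite adj_irrefl.
Qed.

Lemma degree_in_punctured_component (v x : G) : 0 < degree v ->
  x \in punctured_component v ->
  degree_in (~: punctured_component v) x <= adj x v.
Proof.
move=> hv xC; apply: leq_trans (degree_in_component_in (a_neighbour_in hv) xC) _.
rewrite /degree_in; case: (boolP (adj x v)) => [_|xv].
  rewrite -[nat_of_bool true](cards1 v).
  by apply/subset_leq_card/subsetP => u; rewrite !inE negbK => /andP[].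
rewrite leqn0 cards_eq0; apply/eqP/setP => u; rewrite !inE negbK.
by case: eqP => // ->; rewrite (negbTE xv).
Qed.

(** An isolated [x] would be the whole component, hence the chosen neighbour of [v], which is not
    isolated. *)
Lemma punctured_component_degree_gt0 (v x : G) : 0 < degree v ->
  x \in punctured_component v -> 0 < degree x.
Proof.
move=> hv xC; rewrite lt0n; apply/eqP => dx.
have hx : punctured_component v = [set x].
  apply: connected_isolated => //; first exact: component_in_connected.
  by have := degree_inC (punctured_component v) x; lia.
have := component_in_refl [set~ v] (a_neighbour v).
rewrite -/(punctured_component v) hx inE => /eqP ex.
by have := adj_a_neighbour hv; rewrite ex adj_sym => /adj_degree_gt0; rewrite dx.
Qed.

(* The vertex v is the only vertex outside its component that is adjacent to it. *)
Lemma punctured_component_inj :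
  {in [set v : G | 0 < degree v] &, injective punctured_component}.
Proof.
move=> v w; rewrite !inE => hv hw e; apply/eqP.
have vC : v \notin punctured_component w.
  rewrite -e; apply/negP => /(subsetP (component_in_sub (a_neighbour_in hv))).
  by rewrite !inE eqxx.
apply: contraR vC => vw.
apply: (component_in_step (a_neighbour_in hw) (u := a_neighbour v)).
- by rewrite -/(punctured_component w) -e component_in_refl.
- by rewrite !inE.
- by rewrite adj_sym adj_a_neighbour.
Qed.

End PuncturedComponent.

Lemma card_bigcup_le (T I : finType) (P : {set I}) (F : I -> {set T}) (m : nat) :
  (forall i, i \in P -> #|F i| <= m) -> #|\bigcup_(i in P) F i| <= #|P| * m.
Proof.
move=> hF; rewrite -sum_nat_const.
elim/big_ind2 : _ => [|a A b B hA hB|]; [by rewrite cards0 | | exact: hF].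
exact: leq_trans (leq_card_setU A B).1 (leq_add hA hB).
Qed.

(** * Graphs sharing the polynomial of a regular graph *)

Section SamePolynomial.

Variables (d : nat) (G H : sgraph).
Hypotheses (hG : regular d G) (hpoly : alliance_poly H = alliance_poly G).

(** A truncated difference; [same_poly_order_le] shows that nothing is cut off. *)
Let t := gorder H - gorder G.

Lemma same_poly_order_max_degree : gorder H + d = gorder G + max_degree H.
Proof.
have h1 := order_sub_max_degree_le hpoly.
have h2 := order_sub_max_degree_le (esym hpoly).
have := max_degree_lt_order H; have := max_degree_lt_order G.
by rewrite (regular_max_degree hG) in h1 h2 *; lia.
Qed.

Lemma same_poly_card_max_degree :
  #|[set v : H | degree v == max_degree H]| = gorder G.
Proof.
rewrite -card_index_sets_min (card_index_sets_shift _ hpoly).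
have -> : (- (max_degree H)%:Z + (gorder H)%:Z - (gorder G)%:Z)%R
    = (- (max_degree G)%:Z)%R.
  by have := same_poly_order_max_degree; rewrite (regular_max_degree hG); lia.
rewrite card_index_sets_min -[RHS]cardsT; apply: eq_card => v.
by rewrite !inE (regular_max_degree hG) hG eqxx.
Qed.

Lemma same_poly_order_le : gorder G <= gorder H.
Proof. by rewrite -same_poly_card_max_degree max_card. Qed.

Lemma same_poly_order : gorder H = gorder G + t.
Proof. by have := same_poly_order_le; rewrite /t; lia. Qed.

Lemma same_poly_max_degree : max_degree H = d + t.
Proof. by have := same_poly_order_max_degree; have := same_poly_order; lia. Qed.

(** Index [k] in [H] has the same exponent as index [k + t] in [G], so the parity of the indices of
    [G] carries over. *)
Lemma same_poly_index (k : int) (S : {set H}) : S \in index_sets H k ->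
  exists2 a : nat, a <= d & (k + t%:Z = 2 * a%:Z - d%:Z)%R.
Proof.
move=> hS; have : 0 < #|index_sets H k| by apply/card_gt0P; exists S.
rewrite (card_index_sets_shift _ hpoly) => /card_gt0P[S' /(index_sets_regular hG)].
by case=> a ad hk; exists a => //; have := same_poly_order; lia.
Qed.

Lemma same_poly_exact_index_le (S : {set H}) :
  S != set0 -> induced_connected S -> (exact_index S <= d%:Z - t%:Z)%R.
Proof.
move=> S0 cS; have hS : S \in index_sets H (exact_index S) by apply/index_setsP.
by have [a] := same_poly_index hS; lia.
Qed.

Lemma same_poly_degree (v : H) :
  exists2 a : nat, a <= d & degree v + 2 * a = d + t.
Proof.
by have [a ad ha] := same_poly_index (set1_index_sets v); exists a => //; lia.
Qed.

(** A full component of [H] has no outgoing edges, so its index is nonnegative, yet it is at most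
    [d - t]. *)
Lemma same_poly_excess_le : t <= d.
Proof.
have [v _] := max_degree_attained H.
have S0 := component_in_neq0 setT v; have cS := component_in_connected setT v.
have := same_poly_exact_index_le S0 cS.
suff : (0 <= exact_index (component_in setT v))%R by lia.
apply: exact_index_ge => // u uC.
by have := degree_in_component_in (in_setT v) uC; rewrite setCT degree_in0; lia.
Qed.

Lemma same_poly_card_max_index :
  #|index_sets H (d%:Z - t%:Z)%R| = num_components G.
Proof.
rewrite (card_index_sets_shift _ hpoly) -(card_index_sets_regular_max hG).
congr #|pred_of_set (index_sets G _)|; have := same_poly_order; lia.
Qed.

Lemma same_poly_punctured_index (v : H) :
  d <= 3 -> 0 < t -> degree v = d + t ->
  (forall x, adj x v -> degree x <> d - t) ->
  punctured_component v \in index_sets H (d%:Z - t%:Z)%R.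
Proof.
move=> d3 t0 dv hv; have dv0 : 0 < degree v by lia.
have S0 := component_in_neq0 [set~ v] (a_neighbour v).
have cS := component_in_connected [set~ v] (a_neighbour v).
apply/index_setsP; split=> //; apply/le_anti/andP; split.
  exact: same_poly_exact_index_le.
apply: exact_index_ge => // x xC.
have := degree_in_punctured_component dv0 xC.
have := punctured_component_degree_gt0 dv0 xC.
have := degree_inC (punctured_component v) x.
have [a] := same_poly_degree x; have td := same_poly_excess_le; have := hv x.
(* As [d - t <= 2], a positive degree with the parity of [d - t] is at least [d - t]. A neighbour of
   [v] avoids that value, so it has degree at least [d - t + 2], which makes up for its edge to
   [v]. *)
rewrite -/(punctured_component v); case: (adj x v) => [/(_ isT)|_] /=; lia.
Qed.

Lemma same_poly_excess_eq0 : d <= 3 -> t = 0.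
Proof.
move=> d3; apply/eqP; rewrite eqn0Ngt; apply/negP => t0.
have td := same_poly_excess_le.
pose High := [set v : H | degree v == d + t].
pose L := [set x : H | degree x == d - t].
pose Bad := \bigcup_(x in L) [set u in [set: H] | adj x u].
have cHigh : #|High| = gorder G.
  by rewrite -same_poly_card_max_degree same_poly_max_degree.
(* [L] misses [High] because [0 < t], and only [t] vertices lie outside [High]. *)
have cL : #|L| <= t.
  have : #|L| <= #|~: High|.
    by apply/subset_leq_card/subsetP => x; rewrite !inE; lia.
  by have := cardsC High; have := same_poly_order; rewrite /gorder -/High in cHigh *; lia.
have cBad : #|Bad| <= t * (d - t).
  apply: leq_trans (leq_mul cL (leqnn _)); apply: card_bigcup_le => x.
  by rewrite inE => /eqP <-.
have cGood : #|High| - #|Bad| <= #|High :\: Bad|.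
  by rewrite cardsD leq_sub2l // subset_leq_card // subsetIr.
have : #|High :\: Bad| <= num_components G.
  rewrite -same_poly_card_max_index -(@card_in_imset _ _ (@punctured_component H)).
    apply/subset_leq_card/subsetP => S /imsetP[v]; rewrite inE => /andP[vB].
    rewrite inE => /eqP dv ->; apply: same_poly_punctured_index => // x xv dx.
    by case/negP: vB; apply/bigcupP; exists x; rewrite !inE ?dx.
  move=> v w; rewrite !inE => /andP[_ /eqP dv] /andP[_ /eqP dw].
  by apply: punctured_component_inj; rewrite inE; lia.
have := num_components_regular_le hG.
(* A finite check that needs [d <= 3]: it fails for [d = 4], [t = 2]. It gives more than n - d good
   vertices, against at most n - d components. *)
have : t * (d - t) < d.
  by move: t d d3 t0 td => [|[|[|[|t']]]] [|[|[|[|d']]]].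
have := max_degree_lt_order G; rewrite (regular_max_degree hG).
by lia.
Qed.

End SamePolynomial.

Theorem theorem3p1 (Delta : nat) (G Gstar : sgraph)
    (hDelta : (Delta <= 3)%N) (hG : regular Delta G)
    (hpoly : alliance_poly Gstar = alliance_poly G) :
  regular Delta Gstar /\
  gorder Gstar = gorder G /\
  gsize Gstar = gsize G /\
  num_components Gstar = num_components G.
Proof.
have t0 := same_poly_excess_eq0 hG hpoly hDelta.
have ho : gorder Gstar = gorder G.
  by rewrite (same_poly_order hG hpoly) t0 addn0.
have hm : max_degree Gstar = Delta.
  by rewrite (same_poly_max_degree hG hpoly) t0 addn0.
have hS : regular Delta Gstar.
  move=> v; have := same_poly_card_max_degree hG hpoly.
  rewrite -ho hm /gorder => hc.
  (* Now that the orders agree, the n vertices of maximum degree are all the vertices. *)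
  have hT : [set v : Gstar | degree v == Delta] = setT.
    by apply/eqP; rewrite eqEcard subsetT cardsT hc leqnn.
  by have := in_setT v; rewrite -hT inE => /eqP.
split=> //; split=> //; split.
  suff : 2 * gsize Gstar = 2 * gsize G by lia.
  rewrite -!sum_degree (eq_bigr (fun=> Delta)) // [RHS](eq_bigr (fun=> Delta)) //.
  by rewrite !sum_nat_const; congr (_ * _); apply: ho.
rewrite -(card_index_sets_regular_max hS) -(same_poly_card_max_index hG hpoly).
by rewrite t0 subr0.
Qed.
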